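(* For every function $f:\mathbb N\to\mathbb N$ there exist a finite vector configuration $A\subseteq\mathbb Z^n$ and a Markov basis $M$ of the toric ideal $I_A$ such that $|M|>f(|Gr_A|)$, $|M|>f(|\mathcal U_A|)$ and $|M|>f(|\mathcal C_A|)$. That is, the size of a Markov basis of a toric ideal cannot be bounded above by any function of the size of the Graver basis, of the universal Gröbner basis, or of the set of circuits of the ideal.
   Context: Let $\mathbb K$ be a field and $A=\{\mathbf a_1,\dots,\mathbf a_m\}$ a finite set of vectors in $\mathbb Z^n$. For $\mathbf u\in\mathbb N^m$ write $\mathbf x^{\mathbf u}=x_1^{u_1}\cdots x_m^{u_m}$ and $\deg_A(\mathbf x^{\mathbf u})=\sum_i u_i\mathbf a_i$. The toric ideal $I_A\subseteq\mathbb K[x_1,\dots,x_m]$ is the ideal generated by all binomials $\mathbf x^{\mathbf u}-\mathbf x^{\mathbf v}$ with $\deg_A(\mathbf x^{\mathbf u})=\deg_A(\mathbf x^{\mathbf v})$. An irreducible binomial $\mathbf x^{\mathbf u}-\mathbf x^{\mathbf v}\in I_A$ is primitive if there is no other binomial $\mathbf x^{\mathbf w}-\mathbf x^{\mathbf z}\in I_A$ with $\mathbf x^{\mathbf w}\mid\mathbf x^{\mathbf u}$ and $\mathbf x^{\mathbf z}\mid\mathbf x^{\mathbf v}$; the Graver basis $Gr_A$ is the set of primitive binomials. The universal Gröbner basis $\mathcal U_A$ is the union of the reduced Gröbner bases of $I_A$ over all term orders. A circuit is an irreducible nonzero binomial of $I_A$ with minimal support (set of variables occurring), and $\mathcal C_A$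 is the set of circuits. A Markov basis of $I_A$ is a generating set of $I_A$ consisting of binomials that is minimal with respect to inclusion. (Binomials are considered up to sign.) *)

(* Defs.v *)
From HB Require Import structures.
From mathcomp Require Export all_boot all_order all_algebra finmap.
From mathcomp Require Export mpoly.

Set Implicit Arguments.
Unset Strict Implicit.
Unset Printing Implicit Defensive.

Import GRing.Theory.

Local Open Scope ring_scope.

Section Polynomials.
Variables (K : fieldType) (m : nat).
Implicit Types (S I : {mpoly K[m]} -> Prop) (p q g : {mpoly K[m]}).
Implicit Types (u v w z : 'X_{1..m}) (le : rel 'X_{1..m}).

Definition ideal_gen S p : Prop :=
  exists s : seq ({mpoly K[m]} * {mpoly K[m]}),
    (forall c, c \in s -> S c.2) /\ p = \sum_(c <- s) c.1 * c.2.

Definition binomial p : Prop := exists u v, u <> v /\ p = 'X_[u] - 'X_[v].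

Definition irreducible p : Prop :=
  [/\ p != 0, p \isn't a GRing.unit &
      forall q g, p = q * g -> q \is a GRing.unit \/ g \is a GRing.unit].

Definition vars p : {set 'I_m} :=
  [set i | has (fun u : 'X_{1..m} => u i != 0%N) (msupp p)].

Definition term_order le : Prop :=
  [/\ total le, antisymmetric le, transitive le,
      forall u, le 0%MM u &
      forall u v w, le u v -> le (u + w)%MM (v + w)%MM].

Definition is_lead le p u : Prop :=
  u \in msupp p /\ (forall v, v \in msupp p -> le v u).

Definition initial_ideal le S : {mpoly K[m]} -> Prop :=
  ideal_gen (fun q => exists p u, [/\ S p, is_lead le p u & q = 'X_[u]]).

Definition groebner_basis le I (G : {fset {mpoly K[m]}}) : Prop :=
  (forall g, g \in G -> I g) /\
  (forall q, initial_ideal le (fun g => g \in G) q <-> initial_ideal le I q).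

(* On exponents, [(w <= v)%MM] is the componentwise order, i.e. divisibility
   of the monomials. *)
Definition reduced_groebner_basis le I (G : {fset {mpoly K[m]}}) : Prop :=
  groebner_basis le I G /\
  (forall g, g \in G ->
     (exists u, is_lead le g u /\ g@_u = 1) /\
     (forall h w v, h \in G -> h <> g -> is_lead le h w ->
        v \in msupp g -> ~~ (w <= v)%MM)).

Definition universal_groebner_basis I p : Prop :=
  exists le (G : {fset {mpoly K[m]}}),
    [/\ term_order le, reduced_groebner_basis le I G & p \in G].

(* [S] has exactly [N] elements when [p] and [- p] are identified; [s] is a
   system of representatives. *)
Definition card_up_to_sign S (N : nat) : Prop :=
  exists s : {fset {mpoly K[m]}},
    [/\ #|` s| = N,
        forall p, p \in s -> S p,
        forall p, S p -> p \in s \/ - p \in s &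
        forall p q, p \in s -> q \in s -> p = - q -> p = q].

End Polynomials.

Section Toric.
Variables (K : fieldType) (n m : nat) (a : 'I_m -> 'rV[int]_n).
Implicit Types (p q : {mpoly K[m]}) (u v w z : 'X_{1..m}).

Definition degA u : 'rV[int]_n := \sum_(i < m) a i *+ u i.

Definition toric_ideal : {mpoly K[m]} -> Prop :=
  ideal_gen (fun p => exists u v, degA u = degA v /\ p = 'X_[u] - 'X_[v]).

Definition graver p : Prop :=
  exists u v, [/\ u <> v, p = 'X_[u] - 'X_[v], irreducible p, toric_ideal p &
    forall w z, w <> z -> toric_ideal ('X_[w] - 'X_[z]) ->
      (w <= u)%MM -> (z <= v)%MM -> 'X_[w] - 'X_[z] = p].

Definition circuit p : Prop :=
  [/\ binomial p, irreducible p, toric_ideal p &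
      forall q, binomial q -> toric_ideal q -> ~~ (vars q \proper vars p)].

Definition generates_toric (M : {fset {mpoly K[m]}}) : Prop :=
  forall p, ideal_gen (fun q => q \in M) p <-> toric_ideal p.

(* By minimality [M] never contains both [p] and [- p] for [p <> - p], so
   [#|` M|] already counts the binomials of [M] up to sign. *)
Definition markov_basis (M : {fset {mpoly K[m]}}) : Prop :=
  [/\ forall p, p \in M -> binomial p, generates_toric M &
      forall M' : {fset {mpoly K[m]}}, (M' `<` M)%fset -> ~ generates_toric M'].

End Toric.

(* Main.v *)
(** The configuration consists of the single vector [0], so [m = 1] and the
    toric ideal is the principal ideal [(x - 1)] of [K[x]]; its Graver basis,
    its universal Groebner basis and its set of circuits are all [{x - 1}] up to
    sign.  Since [(x^a - 1, x^b - 1) = (x^gcd(a, b) - 1)], any finite set of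
    exponents with gcd 1, none of which can be dropped, yields a Markov basis.
    For distinct primes [p_1, ..., p_k] the [k] exponents
    [e_i = \prod_(j != i) p_j] have this property, with [k] arbitrary. *)

Require Import Defs.

Set Implicit Arguments.
Unset Strict Implicit.
Unset Printing Implicit Defensive.

Import GRing.Theory.

(** * Ideal membership, units and counting up to sign *)

Section Ideal.
Local Open Scope ring_scope.
Variables (K : fieldType) (m : nat).
Implicit Types (S T : {mpoly K[m]} -> Prop) (p q g : {mpoly K[m]}).

Lemma ideal_gen_mem S p : S p -> ideal_gen S p.
Proof.
move=> Sp; exists [:: (1, p)]; split; last by rewrite big_seq1 mul1r.
by move=> c; rewrite inE => /eqP ->.
Qed.

Lemma ideal_gen0 S : ideal_gen S 0.
Proof. by exists [::]; split=> //; rewrite big_nil. Qed.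

Lemma ideal_genD S p q : ideal_gen S p -> ideal_gen S q -> ideal_gen S (p + q).
Proof.
move=> [s [Ss ->]] [t [St ->]]; exists (s ++ t); split; last by rewrite big_cat.
by move=> c; rewrite mem_cat => /orP[/Ss|/St].
Qed.

Lemma ideal_genMl S p q : ideal_gen S q -> ideal_gen S (p * q).
Proof.
move=> [s [Ss ->]]; exists [seq (p * c.1, c.2) | c <- s]; split.
  by move=> c /mapP[d /Ss Sd ->].
by rewrite big_map mulr_sumr; apply: eq_bigr => c _; rewrite mulrA.
Qed.

Lemma ideal_genN S p : ideal_gen S p -> ideal_gen S (- p).
Proof. by rewrite -mulN1r; apply: ideal_genMl. Qed.

Lemma ideal_gen_sub S T p :
  (forall q, S q -> ideal_gen T q) -> ideal_gen S p -> ideal_gen T p.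
Proof.
move=> ST [s [Ss ->]]; elim: s Ss => [|c s IHs] Ss.
  by rewrite big_nil; apply: ideal_gen0.
rewrite big_cons; apply: ideal_genD.
  by apply/ideal_genMl/ST/Ss; rewrite mem_head.
by apply: IHs => d ds; apply: Ss; rewrite inE ds orbT.
Qed.

(** Serves twice: to place the toric ideal inside the ideal of [x - 1], and to confine the ideal of
    too few generators to that of [x ^+ p - 1]. *)
Lemma ideal_gen_principal S p q :
  (forall g, S g -> exists h, g = h * p) -> ideal_gen S q ->
  exists h, q = h * p.
Proof.
move=> Sp [s [Ss ->]]; elim: s Ss => [|c s IHs] Ss.
  by exists 0; rewrite big_nil mul0r.
have [c' defc] := Sp _ (Ss c (mem_head _ _)).
have [|h defs] := IHs; first by move=> d ds; apply: Ss; rewrite inE ds orbT.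
by exists (c.1 * c' + h); rewrite big_cons defs defc mulrA mulrDl.
Qed.

(** Bézout: if [u * a = v * b + g] with [g] the gcd, then [p ^+ g - 1] is [p ^+ (u * a) - 1] minus
    [p ^+ g] times [p ^+ (v * b) - 1], and [p ^+ c - 1] divides [p ^+ (k * c) - 1]. *)
Lemma ideal_gen_expr_gcd S p a b :
  ideal_gen S (p ^+ a - 1) -> ideal_gen S (p ^+ b - 1) ->
  ideal_gen S (p ^+ gcdn a b - 1).
Proof.
move=> Sa Sb; have expM k c : ideal_gen S (p ^+ c - 1) ->
    ideal_gen S (p ^+ (k * c) - 1).
  move=> Sc; rewrite mulnC exprM subrX1 mulrC.
  exact: ideal_genMl.
have [->|a_gt0] := posnP a; first by rewrite gcd0n.
have [u v /= def_g _] := egcdnP b a_gt0.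
have -> : p ^+ gcdn a b - 1 = (p ^+ (u * a) - 1)
    - p ^+ gcdn a b * (p ^+ (v * b) - 1).
  by rewrite def_g addnC exprD mulrBr mulr1 opprB [RHS]addrC addrA addrNK.
by apply: ideal_genD; [|apply/ideal_genN/ideal_genMl]; apply: expM.
Qed.

Lemma mpoly_unitE p : (p \is a GRing.unit) = (msize p == 1%N).
Proof.
apply/idP/msize_poly1P => [/andP[/eqP def_p p0]|[c c_neq0 ->]].
  by exists p@_0; rewrite // -unitfE.
by apply/andP; rewrite mcoeffC eqxx mulr1 unitfE.
Qed.

Lemma card_up_to_sign1 S p :
  S p -> (forall q, S q -> q = p \/ q = - p) -> card_up_to_sign S 1.
Proof.
move=> Sp Sq; exists [fset p]%fset; split; first exact: cardfs1.
- by move=> q /fset1P ->.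
- move=> q /Sq[] ->; [left | right]; rewrite ?opprK; exact/fset1P.
- by move=> q g /fset1P -> /fset1P ->.
Qed.

End Ideal.

(** * Distinct primes and the products of all but one of them *)

Section PrimeCofactor.
Implicit Types (s : seq nat) (p q : nat).

Definition cofactor s p := \prod_(q <- s | q != p) q.

Lemma distinct_primes k :
  exists s, [/\ uniq s, size s = k & all prime s].
Proof.
elim: k => [|k [s [uniq_s size_s prime_s]]]; first by exists [::].
(* A prime above the sum of [s] exceeds each member of [s], so it is new. *)
have [p ltp prime_p] := prime_above (\sum_(q <- s) q).
exists (p :: s); split=> /=; [rewrite uniq_s andbT | by rewrite size_s |].
  apply/negP => ps; move: ltp; rewrite (big_rem p) //=.
  by rewrite ltnNge leq_addr.
by rewrite prime_p.
Qed.

Lemma dvdn_cofactor s p q : all prime s -> prime q ->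
  (q %| cofactor s p) = (q \in s) && (q != p).
Proof.
move=> /allP prime_s prime_q; rewrite Euclid_dvd_prod // big_has_cond.
apply/hasP/andP => [[r rs /andP[neq_rp]]|[qs neq_qp]].
  by rewrite dvdn_prime2 ?(prime_s r) // => /eqP ->.
by exists q => //=; rewrite neq_qp dvdnn.
Qed.

Lemma cofactor_gt0 s p : all prime s -> 0 < cofactor s p.
Proof.
move=> /allP prime_s; rewrite /cofactor big_seq_cond.
by apply: prodn_cond_gt0 => q /andP[/prime_s /prime_gt0].
Qed.

(** A prime of [s] divides the cofactor of every other prime of [s], but not its own. *)
Lemma cofactor_inj s : all prime s -> {in s &, injective (cofactor s)}.
Proof.
move=> prime_s p q ps qs eq_pq; apply/eqP/negPn/negP => neq_pq.
have prime_p : prime p by apply: (allP prime_s).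
have := dvdn_cofactor p prime_s prime_p.
by rewrite eq_pq dvdn_cofactor // ps neq_pq eqxx.
Qed.

(** A prime divisor of the gcd divides every cofactor, hence lies in [s], yet it cannot divide its
    own cofactor. For empty [s] the gcd would be 0. *)
Lemma gcd_cofactor s : 0 < size s -> all prime s ->
  \big[gcdn/0]_(p <- s) cofactor s p = 1.
Proof.
move=> s_gt0 prime_s; set g := \big[_/_]_(_ <- _) _.
have g_dvd p : p \in s -> g %| cofactor s p.
  by move=> ps; rewrite /g (big_rem p) //= dvdn_gcdl.
have p0s : head 0 s \in s by case: (s) s_gt0 => //= p t _; rewrite mem_head.
have g_gt0 : 0 < g.
  exact: dvdn_gt0 (cofactor_gt0 _ prime_s) (g_dvd _ p0s).
apply/eqP/negPn/negP => neq_g1.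
have prime_q : prime (pdiv g) by rewrite pdiv_prime // ltn_neqAle eq_sym neq_g1.
have q_dvd p : p \in s -> (pdiv g \in s) && (pdiv g != p).
  move=> ps; rewrite -dvdn_cofactor //.
  exact: dvdn_trans (pdiv_dvd g) (g_dvd _ ps).
have /andP[qs _] := q_dvd _ p0s.
by have := q_dvd _ qs; rewrite eqxx andbF.
Qed.

End PrimeCofactor.

(** * Monomials, term orders and degrees in one variable *)

Section OneVariable.
Local Open Scope ring_scope.
Variable K : fieldType.
Implicit Types (p q g : {mpoly K[1]}) (u v w : 'X_{1..1}).

Local Notation x := ('X_ord0 : {mpoly K[1]}).

Lemma mnm_one_var u : u = (U_(ord0) *+ mdeg u)%MM.
Proof.
by apply/mnmP => i; rewrite ord1 mulmnE mnm1E eqxx mul1n mdegE big_ord1.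
Qed.

Lemma mdeg_inj u v : mdeg u = mdeg v -> u = v.
Proof. by rewrite [u]mnm_one_var [v]mnm_one_var !mdegMn !mdeg1 !mul1n => ->. Qed.

Lemma lem_one_var u v : (u <= v)%MM = (mdeg u <= mdeg v)%N.
Proof.
rewrite !mdegE !big_ord1; apply/mnm_lepP/idP => [//|le_uv i].
by rewrite ord1.
Qed.

Lemma mpolyX_one_var u : 'X_[u] = x ^+ mdeg u :> {mpoly K[1]}.
Proof. by rewrite {1}[u]mnm_one_var mpolyXn. Qed.

(** Every term order refines divisibility, which is already total in one variable. Hence the union
    over all term orders involves a single order. *)
Lemma term_order_one_var le u v :
  term_order le -> le u v = (mdeg u <= mdeg v)%N.
Proof.
case=> le_total le_anti _ le0 leD.
have le_of_leq w z : (mdeg w <= mdeg z)%N -> le w z.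
  rewrite -lem_one_var => le_wz; rewrite -(submK le_wz) -{1}[w]add0m.
  exact: leD.
apply/idP/idP => [le_uv|/le_of_leq//]; rewrite leqNgt; apply/negP => lt_vu.
have le_vu := le_of_leq _ _ (ltnW lt_vu).
by move: lt_vu; rewrite (le_anti u v) ?ltnn ?le_uv.
Qed.

Lemma term_order_mdeg : term_order (fun u v => mdeg u <= mdeg v)%N.
Proof.
split=> [u v|u v|v u w|u|u v w].
- exact: leq_total.
- by move=> /anti_leq; apply: mdeg_inj.
- exact: leq_trans.
- by rewrite mdeg0.
- by rewrite !mdegD leq_add2r.
Qed.

Lemma msize_exprX_sub1 k : (0 < k)%N -> msize (x ^+ k - 1) = k.+1.
Proof.
move=> k_gt0; apply/eqP; rewrite eqn_leq; apply/andP; split.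
  apply: leq_trans (msizeD_le _ _) _.
  by rewrite msizeN msize1 mpolyXn msizeX mdegMn mdeg1 mul1n geq_max leqnn.
have {1}-> : k = mdeg (U_(ord0 : 'I_1) *+ k)%MM by rewrite mdegMn mdeg1 mul1n.
apply: msize_mdeg_lt.
rewrite mcoeff_msupp mcoeffB mpolyXn mcoeffX eqxx mcoeff1.
by rewrite -mdeg_eq0 mdegMn mdeg1 mul1n eqn0Ngt k_gt0 subr0 oner_neq0.
Qed.

Lemma msizeX_sub1 : msize (x - 1) = 2.
Proof. by rewrite -[x]expr1 msize_exprX_sub1. Qed.

Lemma X_sub1_neq0 : x - 1 != 0.
Proof. by rewrite -msize_poly_eq0 msizeX_sub1. Qed.

Lemma msize_mulX_sub1 g : g != 0 -> msize (g * (x - 1)) = (msize g).+1.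
Proof.
by move=> g_neq0; rewrite msizeM ?X_sub1_neq0 // msizeX_sub1 addn2.
Qed.

(** Since [msize] is the degree plus one, the sizes of two factors add up to 3, so one factor has
    size 1 and is a unit. *)
Lemma X_sub1_irreducible : irreducible (x - 1).
Proof.
split; rewrite ?X_sub1_neq0 ?mpoly_unitE ?msizeX_sub1 // => q g eq_qg.
have := X_sub1_neq0; rewrite eq_qg mulf_eq0 => /norP[q_neq0 g_neq0].
have := msizeM q_neq0 g_neq0; rewrite -eq_qg msizeX_sub1 !mpoly_unitE.
move: q_neq0 g_neq0; rewrite -!msize_poly_eq0.
case: (msize q) => [|[|[|a]]] // _; case: (msize g) => [|[|[|b]]] //= _;
  by [left | right | rewrite ?addnS].
Qed.

(** * The toric ideal of the zero vector *)

Section ZeroVector.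
Variable n : nat.

Local Notation a0 := (fun _ : 'I_1 => 0 : 'rV[int]_n).
Local Notation I0 := (toric_ideal (K := K) a0).

Lemma toric_ideal0_binomial u v : I0 ('X_[u] - 'X_[v]).
Proof.
apply: ideal_gen_mem; exists u, v; split=> //.
by rewrite /degA !big_ord1 !mul0rn.
Qed.

Lemma toric_ideal0P p : I0 p <-> exists g, p = g * (x - 1).
Proof.
split=> [|[g ->]]; last first.
  rewrite -[x]/('X_[U_(ord0)]) -mpolyX0; apply: ideal_genMl.
  exact: toric_ideal0_binomial.
apply: ideal_gen_principal => _ [u [v [_ ->]]].
(* The geometric sums are the quotients of ['X_[u] - 1] and ['X_[v] - 1] by [x - 1]. *)
exists (\sum_(i < mdeg u) x ^+ i - \sum_(i < mdeg v) x ^+ i).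
rewrite mulrC mulrBr -!subrX1 (mpolyX_one_var u) (mpolyX_one_var v) opprB addrA.
by rewrite addrNK.
Qed.

Lemma toric_ideal0_X_sub1 : I0 (x - 1).
Proof. by apply/toric_ideal0P; exists 1; rewrite mul1r. Qed.

Lemma toric_ideal0_linear p :
  I0 p -> (msize p <= 2)%N -> exists c, p = c *: (x - 1).
Proof.
move=> /toric_ideal0P[g ->]; have [->|g_neq0] := eqVneq g 0.
  by exists 0; rewrite mul0r scale0r.
rewrite msize_mulX_sub1 // ltnS => /msize1_polyC ->.
by exists g@_0; rewrite mul_mpolyC.
Qed.

Lemma toric_ideal0_msize p : I0 p -> p != 0 -> (1 < msize p)%N.
Proof.
move=> /toric_ideal0P[g ->]; rewrite mulf_eq0 => /norP[g_neq0 _].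
by rewrite msize_mulX_sub1 // ltnS lt0n msize_poly_eq0.
Qed.

(** * The Graver basis *)

Lemma graver0 : graver (K := K) a0 (x - 1).
Proof.
exists U_(ord0)%MM, 0%MM; split.
- by apply/eqP; rewrite mnm1_eq0.
- by rewrite mpolyX0.
- exact: X_sub1_irreducible.
- exact: toric_ideal0_X_sub1.
(* Here [z] is 0 and [w] has degree at most 1; degree 0 would give [w = z]. *)
move=> w z neq_wz _; rewrite !lem_one_var mdeg0 mdeg1 leqn0 mdeg_eq0 => + /eqP z0.
rewrite z0 leq_eqVlt ltnS leqn0 mdeg_eq0 => /orP[|/eqP w0]; last first.
  by case: neq_wz; rewrite z0.
by rewrite mpolyX0 mpolyX_one_var => /eqP->.
Qed.

(** One of [u], [v] is nonzero, so [x - 1] or [1 - x] divides [p] termwise, and primitivity forces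
    equality. *)
Lemma graver0_unique p : graver (K := K) a0 p -> p = x - 1 \/ p = - (x - 1).
Proof.
have neq_U0 : U_(ord0)%MM <> 0%MM :> 'X_{1..1} by apply/eqP; rewrite mnm1_eq0.
move=> [u [v [neq_uv _ _ _ prim_p]]].
have [u0|u_gt0] := posnP (mdeg u); last first.
  left; rewrite -(prim_p U_(ord0)%MM 0%MM) ?mpolyX0 ?lem_one_var ?mdeg1 ?mdeg0 //.
  exact: toric_ideal0_X_sub1.
right; rewrite -(prim_p 0%MM U_(ord0)%MM) ?lem_one_var ?mdeg1 ?mdeg0 //.
- by rewrite mpolyX0 opprB.
- exact: nesym.
- exact: toric_ideal0_binomial.
- rewrite lt0n; apply/eqP => v0; apply: neq_uv; apply: mdeg_inj.
  by rewrite u0.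
Qed.

(** * Circuits *)

Lemma circuit0 : circuit (K := K) a0 (x - 1).
Proof.
split.
- exists U_(ord0)%MM, 0%MM; split; last by rewrite mpolyX0.
  by apply/eqP; rewrite mnm1_eq0.
- exact: X_sub1_irreducible.
- exact: toric_ideal0_X_sub1.
(* One of the two distinct monomials of [q] is nonconstant, so [q] involves the only variable. *)
move=> q [u [v [neq_uv defq]]] _; apply/negP => /properP[_ [i _ /negP[]]].
have supp w : mdeg w != 0%N -> q@_w != 0 -> i \in vars q.
  move=> w_neq0 qw; rewrite inE; apply/hasP; exists w; first by rewrite mcoeff_msupp.
  by rewrite ord1; rewrite mdegE big_ord1 in w_neq0.
have [u0|u_neq0] := eqVneq (mdeg u) 0%N; last first.
  apply: (supp u) => //; rewrite defq mcoeffB !mcoeffX eqxx (eq_sym v).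
  by rewrite (introF eqP neq_uv) subr0 oner_neq0.
apply: (supp v); last first.
  rewrite defq mcoeffB !mcoeffX eqxx (introF eqP neq_uv).
  by rewrite sub0r oppr_eq0 oner_neq0.
by apply/eqP => v0; apply: neq_uv; apply: mdeg_inj; rewrite u0.
Qed.

(** Irreducibility makes the quotient of [p] by [x - 1] a constant [c]. The constant coefficient of
    a binomial is 0, 1 or -1, which leaves only 1 and -1 for [c], as [p] is nonzero. *)
Lemma circuit0_unique p : circuit (K := K) a0 p -> p = x - 1 \/ p = - (x - 1).
Proof.
move=> [[u [v [neq_uv defp]]] [p_neq0 _ irr_p] Ip _].
have [c defc] : exists c, p = c *: (x - 1).
  have [g defg] := (toric_ideal0P p).1 Ip.
  case: (irr_p _ _ defg); last by rewrite mpoly_unitE msizeX_sub1.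
  rewrite mpoly_unitE => /eqP g1; apply: toric_ideal0_linear => //.
  rewrite defg msize_mulX_sub1 ?g1 // -msize_poly_eq0.
  by rewrite g1.
have: p@_0 = - c.
  by rewrite defc mcoeffZ mcoeffB mcoeffX mnm1_eq0 mcoeff1 eqxx sub0r mulrN1.
rewrite {1}defp mcoeffB !mcoeffX.
have [u0|_] := eqVneq u 0%MM; have [v0|_] := eqVneq v 0%MM.
- by case: neq_uv; rewrite u0.
- by rewrite subr0 => /eqP; rewrite eq_sym eqr_oppLR => /eqP c1; right;
    rewrite defc c1 scaleN1r.
- by rewrite sub0r => /oppr_inj c1; left; rewrite defc -c1 scale1r.
- rewrite subr0 => /eqP; rewrite eq_sym oppr_eq0 => /eqP c0.
  by move: p_neq0; rewrite defc c0 scale0r eqxx.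
Qed.

(** * The universal Gröbner basis *)

Lemma is_lead_X_sub1 le : term_order le -> is_lead le (x - 1) U_(ord0).
Proof.
move=> le_order; split.
  by rewrite mcoeff_msupp mcoeffB mcoeffX eqxx mcoeff1 mnm1_eq0 subr0 oner_neq0.
move=> v /msize_mdeg_lt; rewrite msizeX_sub1 term_order_one_var //.
by rewrite mdeg1.
Qed.

Lemma is_lead_msize le p u :
  term_order le -> is_lead le p u -> msize p = (mdeg u).+1.
Proof.
move=> le_order [pu max_u]; apply/eqP; rewrite eqn_leq msize_mdeg_lt // andbT.
rewrite msizeE; apply/bigmax_leqP_seq => v pv _.
by rewrite ltnS -(term_order_one_var _ _ le_order) max_u.
Qed.

Lemma toric_ideal0_lead_gt0 le p u :
  term_order le -> I0 p -> is_lead le p u -> (0 < mdeg u)%N.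
Proof.
move=> le_order Ip lead_u; rewrite -ltnS -(is_lead_msize le_order lead_u).
apply: toric_ideal0_msize => //; rewrite -msize_poly_eq0.
by rewrite (is_lead_msize le_order lead_u).
Qed.

Lemma universal_groebner0 : universal_groebner_basis I0 (x - 1).
Proof.
exists (fun u v => mdeg u <= mdeg v)%N, [fset x - 1]%fset.
have lead1 := is_lead_X_sub1 term_order_mdeg.
split; [exact: term_order_mdeg | | exact/fset1P].
split; [split|].
- by move=> g /fset1P ->; apply: toric_ideal0_X_sub1.
- move=> q; split; apply: ideal_gen_sub => _ [g [u [Gg lead_u ->]]].
    apply: ideal_gen_mem; exists g, u; split=> //.
    by move/fset1P: Gg => ->; apply: toric_ideal0_X_sub1.
  (* A leading monomial of positive degree is a multiple of [x], the leading monomial of [x - 1]. *)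
  have := toric_ideal0_lead_gt0 term_order_mdeg Gg lead_u.
  rewrite (mpolyX_one_var u) => /prednK <-; rewrite exprSr.
  apply/ideal_genMl/ideal_gen_mem; exists (x - 1), U_(ord0)%MM.
  by split=> //; apply/fset1P.
move=> g /fset1P ->; split.
  exists U_(ord0)%MM; split=> //.
  by rewrite mcoeffB mcoeffX eqxx mcoeff1 mnm1_eq0 subr0.
by move=> h w v /fset1P ->.
Qed.

(** A reduced basis must contain an element with leading monomial [x]; being monic, it is [x - 1]
    itself, without a choice of sign. *)
Lemma universal_groebner0_unique p : universal_groebner_basis I0 p -> p = x - 1.
Proof.
move=> [le [G [le_order [[GI init_G] red_G] Gp]]].
have [h Gh lead_h] : exists2 h, h \in G & is_lead le h U_(ord0).
  have: initial_ideal le I0 x.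
    apply: ideal_gen_mem; exists (x - 1), U_(ord0)%MM.
    by split; [exact: toric_ideal0_X_sub1 | exact: is_lead_X_sub1 |].
  move=> /(init_G _).2[s [Gs defx]].
  (* The monomial [x] occurs in some summand, a multiple of a leading monomial [u] of [G]. So [u]
     has degree at most 1, and degree 0 is excluded in this ideal. *)
  have: U_(ord0)%MM \in msupp x by rewrite msuppX mem_head.
  rewrite defx => suppU; have /flattenP[t /mapP[c]] := msupp_sum_le suppU.
  rewrite mem_filter /= => cs -> suppcU.
  have /allpairsP[[w z] /= [_ zc defU]] := msuppM_le suppcU.
  have [g [u [Gg lead_u defc]]] := Gs _ cs.
  exists g => //; suff -> : U_(ord0)%MM = u by [].
  move: zc defU; rewrite defc msuppX inE => /eqP -> /(congr1 mdeg).
  rewrite mdegD mdeg1 => defU; apply: mdeg_inj; apply/eqP.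
  rewrite mdeg1 eqn_leq (toric_ideal0_lead_gt0 le_order (GI _ Gg) lead_u) /=.
  exact: leq_trans (leq_addl _ _) (eq_leq (esym defU)).
have defh : h = x - 1.
  have [|c defc] := toric_ideal0_linear (GI _ Gh).
    by rewrite (is_lead_msize le_order lead_h) mdeg1.
  have [[u [lead_u h1]] _] := red_G _ Gh.
  move: h1; have -> : u = U_(ord0)%MM.
    apply: mdeg_inj; apply: succn_inj.
    by rewrite -(is_lead_msize le_order lead_u) (is_lead_msize le_order lead_h).
  rewrite defc mcoeffZ mcoeffB mcoeffX eqxx mcoeff1 mnm1_eq0 subr0 mulr1 => ->.
  by rewrite scale1r.
(* The leading monomial of any other element would be divisible by [x], against reducedness. *)
have [->//|neq_ph] := eqVneq p h.
have [[u [lead_u _]] red_p] := red_G _ Gp.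
have := red_p h U_(ord0)%MM u Gh (fun e => elimN eqP neq_ph (esym e)) lead_h lead_u.1.
by rewrite lem_one_var mdeg1 (toric_ideal0_lead_gt0 le_order (GI _ Gp) lead_u).
Qed.

(** * Markov bases of arbitrary size *)

Definition cofactor_basis (s : seq nat) : {fset {mpoly K[1]}} :=
  [fset x ^+ cofactor s p - 1 | p in s]%fset.

Lemma exprX_sub1_inj : injective (fun k => x ^+ k - 1).
Proof.
move=> k l /addIr /(congr1 (fun p => msize p)).
by rewrite !mpolyXn !msizeX !mdegMn mdeg1 !mul1n => -[].
Qed.

Lemma card_cofactor_basis s :
  uniq s -> all prime s -> #|` cofactor_basis s| = size s.
Proof.
move=> uniq_s prime_s; rewrite card_in_imfset /=.
  by rewrite undup_id.
move=> p q ps qs /exprX_sub1_inj; exact: cofactor_inj.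
Qed.

Lemma cofactor_basis_markov s : (0 < size s)%N -> all prime s ->
  markov_basis a0 (cofactor_basis s).
Proof.
move=> s_gt0 prime_s; split.
- move=> _ /imfsetP[p /= ps ->].
  exists (U_(ord0) *+ cofactor s p)%MM, 0%MM; rewrite mpolyX0 mpolyXn.
  split=> // /(congr1 mdeg)/eqP; rewrite mdegMn mdeg1 mul1n mdeg0.
  by rewrite eqn0Ngt cofactor_gt0.
- move=> q; split.
    apply: ideal_gen_sub => _ /imfsetP[p /= ps ->].
    by apply/toric_ideal0P; rewrite subrX1; eexists; rewrite mulrC.
  move=> /toric_ideal0P[g ->]; apply: ideal_genMl.
  (* The exponent 1 of [x] is read as the gcd of all cofactors, which is then built up one cofactor
     at a time. *)
  rewrite -[x]expr1 -[X in x ^+ X](gcd_cofactor s_gt0 prime_s) big_seq.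
  apply: (big_ind (fun k => ideal_gen _ (x ^+ k - 1))).
  + by rewrite expr0 subrr; apply: ideal_gen0.
  + by move=> k l; apply: ideal_gen_expr_gcd.
  by move=> p ps; apply: ideal_gen_mem; apply/imfsetP; exists p.
move=> M; rewrite fproperE.
move=> /andP[/fsubsetP subM /fsubsetPn[_ /imfsetP[p /= ps ->] notM]] genM.
have prime_p : prime p by apply: (allP prime_s).
(* All exponents occurring in [M] are multiples of [p]. *)
have [] : exists g, x - 1 = g * (x ^+ p - 1).
  apply: ideal_gen_principal ((genM _).2 toric_ideal0_X_sub1) => q Mq.
  have /imfsetP[r /= rs defq] := subM _ Mq.
  have /dvdnP[k defk] : (p %| cofactor s r)%N.
    rewrite dvdn_cofactor // ps /=; apply: contraNneq notM => ->.
    by rewrite -defq.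
  by rewrite defq defk mulnC exprM subrX1; eexists; rewrite mulrC.
move=> g defg; have := X_sub1_neq0; rewrite defg mulf_eq0 => /norP[g_neq0 xp_neq0].
have := msizeM g_neq0 xp_neq0; rewrite -defg msizeX_sub1.
rewrite msize_exprX_sub1 ?prime_gt0 // addnS /= => /eqP.
(* Comparing degrees leaves [msize g + p = 2], impossible for nonzero [g] and prime [p]. *)
have gt2 : (1 + 2 <= msize g + p)%N.
  by rewrite leq_add ?prime_gt1 // lt0n msize_poly_eq0.
by rewrite ltn_eqF.
Qed.

End ZeroVector.
End OneVariable.

Theorem theorem3p3 (K : fieldType) (f : nat -> nat) :
  exists (n m : nat) (a : 'I_m -> 'rV[int]_n) (M : {fset {mpoly K[m]}}),
    [/\ injective a,
        markov_basis a M,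
        exists g, card_up_to_sign (graver (K := K) a) g /\ f g < #|` M|,
        exists g, card_up_to_sign
                    (universal_groebner_basis (toric_ideal (K := K) a)) g /\
                  f g < #|` M| &
        exists g, card_up_to_sign (circuit (K := K) a) g /\ f g < #|` M|].
Proof.
(* All three sets have one element up to sign, so only the value [f 1] has to be exceeded. *)
have [s [uniq_s size_s prime_s]] := distinct_primes (f 1).+1.
have s_gt0 : (0 < size s) by rewrite size_s.
exists 1, 1, (fun=> 0%R), (cofactor_basis K s).
rewrite card_cofactor_basis // size_s; split.
- by move=> i j _; rewrite !ord1.
- exact: cofactor_basis_markov.
- exists 1; split=> //.
  exact: card_up_to_sign1 (graver0 _ _) (@graver0_unique _ _).
- exists 1; split=> //.
  apply: card_up_to_sign1 (universal_groebner0 _ _) _ => q.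
  by move=> /universal_groebner0_unique; left.
- exists 1; split=> //.
  exact: card_up_to_sign1 (circuit0 _ _) (@circuit0_unique _ _).
Qed.
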